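(* Let $\mathcal{S} = \{(x_i,y_i) : i=1,\dots,m\}$ with $x_i \in \mathbb{R}^d$, $y_i \in \{-1,1\}$. Assume $\Theta \subseteq \{\theta \in \mathbb{R}^d : \|\theta\|_2 < r_\theta\}$ for some $r_\theta > 0$. Let $\Sigma_r \subseteq \Sigma_m$ be a fixed nonempty predefined subset, and let $\mathcal{U}$ consist of $n \geq 1$ signatures sampled uniformly i.i.d. from $\Sigma_r$. For $\theta \in \Theta$ let $$\varrho = \frac{\sup_{\theta' \in \Theta} \max_{\sigma \in \Sigma_r} \exp(-\theta'^\top \pi_\sigma)}{F^{r}_{\exp}(\mathcal{S},\theta,\Sigma_r)}, \qquad \varrho' = \frac{F^{r}_{\exp}(\mathcal{S},\theta,\Sigma_r)}{F^{r}_{\exp}(\mathcal{S},\theta,\Sigma_m)}, \qquad Q = -\frac1m \log \varrho'.$$ Then for every $\eta > 0$, with probability at least $1-\eta$ over the sampling of $\mathcal{U}$, every $\theta \in \Theta$ satisfies $$F_{\log}(\mathcal{S},\theta) \;\leq\; F^{r}_{\log}(\mathcal{S},\theta,\mathcal{U}) + Q - \frac1m \cdot \log\left(1 - \frac{q}{\sqrt{n}}\right), \qquad (\ast)$$ with $$q = \Omega\left( \varrho \cdot \sqrt{ r_\theta \max_{\sigma\in\Sigma_r} \|\pi_\sigma\|_2 + d \log\frac{2en}{d} + \log\frac1\eta } \right).$$ Moreover $Q = 0$ if $\Sigma_r = \Sigma_m$, and otherwise $$Q \;\leq\; r_\theta \left( \left\| \nabla_\theta F^{r}_{\log}(\mathcal{S},\theta,\Sigma_m)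 \right\|_2 + \overline{\pi}_r \right), \qquad \overline{\pi}_r = \left\| \mathbb{E}_{\sigma \sim \Sigma_r}\left[ \tfrac1m \pi_\sigma \right] \right\|_2,$$ where the expectation is over $\sigma$ uniform in $\Sigma_r$. Furthermore, for every $0 \leq \beta < 1/2$, if $m$ is sufficiently large, then, letting $\pi_r^* = \max_{\sigma \in \Sigma_r} \left\| \tfrac1m \pi_\sigma \right\|_2$, inequality $(\ast)$ becomes $$F_{\log}(\mathcal{S},\theta) \;\leq\; F^{r}_{\log}(\mathcal{S},\theta,\mathcal{U}) + Q + O\left( \frac{\varrho}{m^\beta} \cdot \sqrt{ \frac{r_\theta \pi_r^*}{n} + \frac{d}{nm} \log \frac{2en}{d\eta} } \right).$$
   Context: $\Sigma_m = \{-1,1\}^m$. For $\sigma \in \Sigma_m$, the Rademacher observation (rado) is $\pi_\sigma = \frac12 \sum_{i=1}^m (\sigma_i + y_i) x_i \in \mathbb{R}^d$. The logistic risk is $F_{\log}(\mathcal{S}, \theta) = \frac1m \sum_{i=1}^m \log\left(1 + \exp(-y_i \theta^\top x_i)\right)$. For a collection $\mathcal{U}$ of $n$ elements of $\Sigma_m$ (counted with multiplicity if sampled i.i.d.), the exponential rado-risk is $F^{r}_{\exp}(\mathcal{S},\theta,\mathcal{U}) = \frac1n \sum_{\sigma \in \mathcal{U}} \exp(-\theta^\top \pi_\sigma)$, and the logistic rado-risk is $F^{r}_{\log}(\mathcal{S},\theta,\mathcal{U}) = \log(2) + \frac1m \log F^{r}_{\exp}(\mathcal{S},\theta,\mathcal{U})$.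 The symbols $\Omega(\cdot)$ and $O(\cdot)$ hide absolute constants: that is, $q$ is a suitable absolute constant times the displayed quantity. Inequality $(\ast)$ is understood when $q < \sqrt n$, so that the logarithm is defined. ''$m$ sufficiently large'' is relative to the other parameters.
   Formalization: The two probabilistic bounds are proved for d ≤ 2n only (for d near 2en inequality (∗) can fail, and for d > 2en q may be undefined); the bound for large m is stated, like (∗), for those θ with q < √n. *)

(* Defs.v *)
From HB Require Import structures.
From mathcomp Require Import all_boot all_order all_algebra.
From mathcomp Require Import all_classical all_reals all_analysis.
Set Implicit Arguments.
Unset Strict Implicit.
Unset Printing Implicit Defensive.
Import Order.TTheory GRing.Theory Num.Theory.
Import numFieldNormedType.Exports.
Local Open Scope ring_scope.

(* MathComp-Analysis, over an arbitrary R : realType. *)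

Definition dotv (R : realType) (d : nat) (u v : 'rV[R]_d) : R :=
  (u *m v^T) 0 0.

(* The norm that the library puts on 'rV[R]_d is the sup norm, so the
   Euclidean norm is defined here. *)
Definition norm2 (R : realType) (d : nat) (v : 'rV[R]_d) : R :=
  Num.sqrt (dotv v v).

Definition grad (R : realType) (d : nat) (f : 'rV[R]_d -> R)
    (theta : 'rV[R]_d) : 'rV[R]_d :=
  \row_j 'D_(delta_mx 0 j) f theta.

(* Sigma_m = {-1,1}^m is encoded by boolean vectors: true is +1, false is -1.
   The labels y_1, ..., y_m use the same encoding. *)
Definition signature (m : nat) := {ffun 'I_m -> bool}.

Definition pm1 (R : realType) (b : bool) : R := if b then 1 else -1.

Definition rado (R : realType) (m d : nat) (x : 'I_m -> 'rV[R]_d)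
    (y s : signature m) : 'rV[R]_d :=
  2^-1 *: \sum_(i < m) (pm1 R (s i) + pm1 R (y i)) *: x i.

Definition log_risk (R : realType) (m d : nat) (x : 'I_m -> 'rV[R]_d)
    (y : signature m) (theta : 'rV[R]_d) : R :=
  m%:R^-1 * \sum_(i < m) ln (1 + expR (- (pm1 R (y i) * dotv theta (x i)))).

(* Collections of signatures are sequences, so repetitions count; a set A of
   signatures is used through its duplicate-free enumeration enum A. *)
Definition exp_rado_risk (R : realType) (m d : nat) (x : 'I_m -> 'rV[R]_d)
    (y : signature m) (U : seq (signature m)) (theta : 'rV[R]_d) : R :=
  (size U)%:R^-1 * \sum_(s <- U) expR (- dotv theta (rado x y s)).

Definition log_rado_risk (R : realType) (m d : nat) (x : 'I_m -> 'rV[R]_d)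
    (y : signature m) (U : seq (signature m)) (theta : 'rV[R]_d) : R :=
  ln 2 + m%:R^-1 * ln (exp_rado_risk x y U theta).

(* Probability of E when the n entries of U are drawn independently, each
   uniformly from the finite set A: the mass function on n-tuples is the product
   of the mass functions of the uniform law on A. *)
Definition iid_prob (R : realType) (T : finType) (A : {set T}) (n : nat)
    (E : n.-tuple T -> Prop) : R :=
  \sum_(U : n.-tuple T | `[< E U >])
    \prod_(i < n) (if tnth U i \in A then #|A|%:R^-1 else 0).

(* The terms maximised below are nonnegative, so starting the iterated maximum
   at 0 does not change its value over a nonempty set. *)
Definition max_exp (R : realType) (m d : nat) (x : 'I_m -> 'rV[R]_d)
    (y : signature m) (A : {set signature m}) (theta : 'rV[R]_d) : R :=
  \big[Num.max/0]_(s in A) expR (- dotv theta (rado x y s)).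

Definition max_rado_norm (R : realType) (m d : nat) (x : 'I_m -> 'rV[R]_d)
    (y : signature m) (A : {set signature m}) : R :=
  \big[Num.max/0]_(s in A) norm2 (rado x y s).

Definition max_scaled_rado_norm (R : realType) (m d : nat)
    (x : 'I_m -> 'rV[R]_d) (y : signature m) (A : {set signature m}) : R :=
  \big[Num.max/0]_(s in A) norm2 (m%:R^-1 *: rado x y s).

Definition mean_scaled_rado (R : realType) (m d : nat)
    (x : 'I_m -> 'rV[R]_d) (y : signature m) (A : {set signature m}) :
    'rV[R]_d :=
  #|A|%:R^-1 *: \sum_(s in A) m%:R^-1 *: rado x y s.

Definition varrho (R : realType) (m d : nat) (x : 'I_m -> 'rV[R]_d)
    (y : signature m) (Theta : set 'rV[R]_d) (Sr : {set signature m})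
    (theta : 'rV[R]_d) : R :=
  sup [set max_exp x y Sr theta' | theta' in Theta]%classic
  / exp_rado_risk x y (enum Sr) theta.

Definition varrho' (R : realType) (m d : nat) (x : 'I_m -> 'rV[R]_d)
    (y : signature m) (Sr : {set signature m}) (theta : 'rV[R]_d) : R :=
  exp_rado_risk x y (enum Sr) theta
  / exp_rado_risk x y (enum [set: signature m]%SET) theta.

Definition bigQ (R : realType) (m d : nat) (x : 'I_m -> 'rV[R]_d)
    (y : signature m) (Sr : {set signature m}) (theta : 'rV[R]_d) : R :=
  - (m%:R^-1 * ln (varrho' x y Sr theta)).

(* The quantity q, with the absolute constant of its Omega made explicit as C. *)
Definition smallq (R : realType) (C : R) (m d : nat) (x : 'I_m -> 'rV[R]_d)
    (y : signature m) (Theta : set 'rV[R]_d) (r : R) (Sr : {set signature m})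
    (n : nat) (eta : R) (theta : 'rV[R]_d) : R :=
  C * (varrho x y Theta Sr theta *
       Num.sqrt (r * max_rado_norm x y Sr
                 + d%:R * ln (2 * expR 1 * n%:R / d%:R) + ln eta^-1)).

Definition deviation_bound (R : realType) (C : R) (m d : nat)
    (x : 'I_m -> 'rV[R]_d) (y : signature m) (Theta : set 'rV[R]_d) (r : R)
    (Sr : {set signature m}) (n : nat) (eta : R) (U : seq (signature m))
    (theta : 'rV[R]_d) : Prop :=
  log_risk x y theta <=
    log_rado_risk x y U theta + bigQ x y Sr theta
    - m%:R^-1 * ln (1 - smallq C x y Theta r Sr n eta theta / Num.sqrt n%:R).

(* The large-m form of the bound, with the absolute constant of its O made
   explicit as C. *)
Definition large_m_bound (R : realType) (C beta : R) (m d : nat)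
    (x : 'I_m -> 'rV[R]_d) (y : signature m) (Theta : set 'rV[R]_d) (r : R)
    (Sr : {set signature m}) (n : nat) (eta : R) (U : seq (signature m))
    (theta : 'rV[R]_d) : Prop :=
  log_risk x y theta <=
    log_rado_risk x y U theta + bigQ x y Sr theta
    + C * (varrho x y Theta Sr theta / m%:R `^ beta *
           Num.sqrt (r * max_scaled_rado_norm x y Sr / n%:R
                     + d%:R / (n%:R * m%:R)
                       * ln (2 * expR 1 * n%:R / (d%:R * eta)))).

(* Main.v *)
Require Import Defs.
From mathcomp Require Import all_boot all_order all_algebra.
From mathcomp Require Import all_classical all_reals all_analysis.
From mathcomp Require Import fintype finset ring lra.
Set Implicit Arguments.
Unset Strict Implicit.
Unset Printing Implicit Defensive.
Import Order.TTheory GRing.Theory Num.Theory.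
Import numFieldNormedType.Exports.
Local Open Scope ring_scope.

(* Since sums over all signatures factorise, log_risk is log_rado_risk over the
   whole of Sigma_m, so the bound reduces to a one-sided relative deviation of
   the exponential rado-risk over the sample from the one over Sr, uniformly in
   theta. The super-level sets of s |-> exp (- theta . pi_s) are half-spaces of
   R^d; integrating over the level, the deviation is at most the supremum of
   these functions times the largest deviation of a half-space. Half-spaces
   shatter at most d + 1 points, so by the Sauer-Shelah bound they leave at most
   exp (2 d ln (2en/d)) traces on 2n points, and an exponential-moment
   symmetrization bounds the probability of a large deviation.
   For Q, convexity bounds the log-partition function over Sigma_m by the scalar
   product of theta with its gradient, and Jensen's inequality bounds the one
   over Sr from below by the mean. *)

(** * Shattering *)

Lemma ler_eq (R : numDomainType) (a b : R) : a = b -> a <= b.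
Proof. by move=> ->. Qed.

Definition shatters (T : finType) (H : {set {set T}}) (A : {set T}) : bool :=
  [forall B : {set T}, (B \subset A) ==> [exists h in H, h :&: A == B]].

Definition traces (T : finType) (H : {set {set T}}) (X : {set T}) :
    {set {set T}} := [set h :&: X | h in H].

Lemma shattersP (T : finType) (H : {set {set T}}) (A : {set T}) :
  reflect (forall B : {set T}, B \subset A -> exists2 h, h \in H & h :&: A = B)
          (shatters H A).
Proof.
apply: (iffP forallP) => HA B.
  by move=> BA; have /implyP/(_ BA)/exists_inP[h hH /eqP] := HA B; exists h.
apply/implyP => /HA[h hH hB]; apply/exists_inP; exists h => //; exact/eqP.
Qed.

Lemma shattersS (T : finType) (H H' : {set {set T}}) (A : {set T}) :
  H \subset H' -> shatters H A -> shatters H' A.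
Proof.
move=> /subsetP HH' /shattersP HA; apply/shattersP => B /HA[h hH hB].
by exists h => //; exact: HH'.
Qed.

(* Splitting H according to membership of a point x: every A shattered by both
   halves yields the two sets A and x |: A shattered by H. *)
Lemma card_le_shattered (T : finType) (H : {set {set T}}) :
  (#|H| <= #|[set A | shatters H A]|)%N.
Proof.
have [k] := ubnP #|H|; elim: k H => // k IH H /ltnSE leHk.
have [H1|] := leqP #|H| 1.
  have [->|[h hH]] := set_0Vmem H; first by rewrite cards0.
  apply: (leq_trans H1); rewrite card_gt0; apply/set0Pn; exists set0.
  rewrite inE; apply/shattersP => B; rewrite subset0 => /eqP ->.
  by exists h => //; rewrite setI0.
case/card_gt1P => h1 [h2 [h1H h2H h12]].
(* Two distinct members differ at some [x], so both halves are nonempty and hence smaller than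
   [H]. *)
have [x xh] : exists x, (x \in h1) != (x \in h2).
  apply/existsP; apply: contra_neqT h12; rewrite negb_exists => /forallP e.
  by apply/setP => x; apply/eqP; have := e x; rewrite negbK.
pose H1 := [set h in H | x \in h]; pose H0 := [set h in H | x \notin h].
have cardH : (#|H| = #|H1| + #|H0|)%N.
  rewrite -(cardsID [set h : {set T} | x \in h]); congr (_ + _)%N; apply: eq_card => h.
    by rewrite !inE.
  by rewrite !inE andbC.
have H1gt0 : (0 < #|H1|)%N.
  rewrite card_gt0; apply/set0Pn; case xh1: (x \in h1) xh => xh.
    by exists h1; rewrite inE h1H.
  by exists h2; rewrite inE h2H; case: (x \in h2) xh.
have H0gt0 : (0 < #|H0|)%N.
  rewrite card_gt0; apply/set0Pn; case xh1: (x \in h1) xh => xh.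
    by exists h2; rewrite inE h2H; case: (x \in h2) xh.
  by exists h1; rewrite inE h1H xh1.
have /IH le1 : (#|H1| < k)%N.
  by apply: leq_trans leHk; rewrite cardH -[ltnLHS]addn0 ltn_add2l.
have /IH le0 : (#|H0| < k)%N.
  by apply: leq_trans leHk; rewrite cardH -[ltnLHS]add0n ltn_add2r.
rewrite cardH; apply: (leq_trans (leq_add le1 le0)).
set S1 := [set A | shatters H1 A]; set S0 := [set A | shatters H0 A].
(* The members of one half agree at [x], so no set it shatters contains [x]; adding [x] is thus
   injective on [S1 :&: S0] and yields sets outside [S1 :|: S0]. *)
have xS1 A : A \in S1 -> x \notin A.
  rewrite inE => /shattersP /(_ set0 (sub0set _)) [h].
  rewrite inE => /andP[_ xh'] hA; apply/negP => xA.
  by move/setP: hA => /(_ x); rewrite !inE xh' xA.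
have xS0 A : A \in S0 -> x \notin A.
  rewrite inE => /shattersP /(_ A (subxx _)) [h].
  rewrite inE => /andP[_ xh'] hA; apply/negP => xA.
  by move/setP: hA => /(_ x); rewrite !inE xA (negbTE xh').
rewrite -cardsUI.
have <- : #|[set x |: A | A in S1 :&: S0]| = #|S1 :&: S0|.
  rewrite card_in_imset // => A B; rewrite !in_setI => /andP[/xS1 xA _].
  by move=> /andP[/xS1 xB _] /(congr1 (fun C => C :\ x)); rewrite !setU1K.
rewrite -cardsUI [X in (_ + X)%N](_ : _ = 0%N) ?addn0; last first.
  apply/eqP; rewrite cards_eq0; apply/eqP/setP => A; rewrite in_set0 in_setI.
  apply/negP => /andP[AS /imsetP[B _ AB]].
  have : x \notin A by move: AS; rewrite in_setU => /orP[/xS1|/xS0].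
  by rewrite AB setU11.
apply/subset_leq_card/subsetP => A; rewrite in_setU => /orP[|].
  rewrite in_setU !inE => /orP[|]; apply: shattersS.
    by apply/subsetP => h; rewrite inE => /andP[].
  by apply/subsetP => h; rewrite inE => /andP[].
case/imsetP => B /[!in_setI] /andP[BS1 BS0] ->; rewrite inE.
have xB := xS1 _ BS1; move: BS1 BS0; rewrite !inE => /shattersP B1 /shattersP B0.
apply/shattersP => C CxB.
have CB : C :\ x \subset B by rewrite subDset.
case xC: (x \in C).
  have [h] := B1 _ CB; rewrite inE => /andP[hH xh'] hB; exists h => //.
  by rewrite setIUr hB (setIidPr _) ?sub1set // setD1K.
have [h] := B0 _ CB; rewrite inE => /andP[hH xh'] hB; exists h => //.
rewrite setIUr hB [h :&: [set x]](_ : _ = set0); last first.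
  by apply/setP => z; rewrite !inE; case: eqVneq => [->|]; rewrite ?(negbTE xh') ?andbF.
rewrite set0U; apply/setP => z; rewrite !inE.
by case: eqVneq => // ->; rewrite xC.
Qed.

(** A set shattered by the traces on [X] lies inside [X] and is shattered by [H]; this gives the
    Sauer-Shelah bound. *)
Lemma card_traces (T : finType) (H : {set {set T}}) (D : nat) (X : {set T}) :
  (forall A, shatters H A -> #|A| <= D)%N ->
  (#|traces H X| <= #|[set A in powerset X | (#|A| <= D)%N]|)%N.
Proof.
move=> HD; apply: (leq_trans (card_le_shattered _)).
apply/subset_leq_card/subsetP => A; rewrite inE => /shattersP HA.
have AX : A \subset X.
  have [_ /imsetP[h _ ->]] := HA A (subxx _).
  by move=> <-; rewrite subIset // subsetIr.
rewrite !inE AX; apply: HD; apply/shattersP => B /HA[_ /imsetP[h hH ->] <-].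
by exists h => //; rewrite -setIA (setIidPr AX).
Qed.

(** As [t <= 1], a set of at most [D] points has weight t^|A| at least t^D, and the weights of all
    subsets of [X] add up to (1 + t)^|X|. Leaving [t] free avoids estimating binomial sums. *)
Lemma card_traces_expr (R : realFieldType) (T : finType) (H : {set {set T}})
    (D : nat) (X : {set T}) (t : R) :
  (forall A, shatters H A -> #|A| <= D)%N -> 0 < t -> t <= 1 ->
  #|traces H X|%:R * t ^+ D <= (1 + t) ^+ #|X|.
Proof.
move=> HD t0 t1.
apply: (@le_trans _ _ (\sum_(A in powerset X | (#|A| <= D)%N) t ^+ D)).
  rewrite sumr_const -[leRHS]mulr_natl; apply: ler_wpM2r; first exact/exprn_ge0/ltW.
  rewrite ler_nat; apply: leq_trans (card_traces _ HD) _.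
  by apply: eq_leq; apply: eq_card => A; rewrite !inE unfold_in !inE.
apply: (@le_trans _ _ (\sum_(A in powerset X) t ^+ #|A|)).
  rewrite big_mkcondr /=; apply: ler_sum => A _; case: ifP => AD.
    by apply: ler_wiXn2l => //; exact: ltW.
  exact/exprn_ge0/ltW.
have -> : (1 + t) ^+ #|X| = \prod_(i : T) ((if i \in X then t else 0) + 1).
  rewrite (bigID (mem X)) /= [X in _ * X]big1 ?mulr1; last first.
    by move=> i /negbTE ->; rewrite add0r.
  by rewrite (eq_bigr (fun=> 1 + t)) ?prodr_const // => i ->; rewrite addrC.
rewrite bigA_distr [leRHS](bigID (mem (powerset X))) /=.
rewrite -[leLHS]addr0; apply: lerD; last first.
  apply: sumr_ge0 => A _; apply: prodr_ge0 => i _.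
  by case: ifP => // _; case: ifP => // _; exact: ltW.
apply: ler_eq; apply: eq_bigr => A; rewrite inE => /subsetP AX.
rewrite (bigID (mem A)) /= [X in _ * X]big1 ?mulr1; last by move=> i /negbTE ->.
by rewrite (eq_bigr (fun=> t)) ?prodr_const // => i iA; rewrite iA (AX _ iA).
Qed.

(** * Half-spaces and uniform deviations *)

Lemma dotv_sum (R : realType) (d : nat) (u v : 'rV[R]_d) :
  dotv u v = \sum_j u 0 j * v 0 j.
Proof. by rewrite /dotv mxE; apply: eq_bigr => j _; rewrite mxE. Qed.

Definition halfspaces (R : realType) (T : finType) (D : nat)
    (v : T -> 'rV[R]_D) : {set {set T}} :=
  [set h | `[< exists w, h = [set s | 0 < dotv w (v s)] >]].

(* A shattered set of more than D points carries a linear dependency c among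
   its vectors; the half-space picking out exactly the points with positive
   coefficient in c contradicts it. *)
Lemma halfspaces_shatters (R : realType) (T : finType) (D : nat)
    (v : T -> 'rV[R]_D) (A : {set T}) :
  shatters (halfspaces v) A -> (#|A| <= D)%N.
Proof.
move=> /shattersP HA; rewrite leqNgt; apply/negP => DA.
pose M : 'M[R]_(#|A|, D) := \matrix_(i < #|A|) v (enum_val i).
have /rowV0Pn[c0 cM c0_neq0] : kermx M != 0.
  rewrite -mxrank_eq0 mxrank_ker subn_eq0 -ltnNge.
  exact: leq_ltn_trans (rank_leq_col M) DA.
have {cM} c0M : c0 *m M = 0 by apply/sub_kermxP.
(* Up to sign, a nonzero dependency has a positive coefficient, which makes the final sum strictly
   positive. *)
have [c [cM [i ci]]] : exists c : 'rV_#|A|, c *m M = 0 /\ exists i, 0 < c 0 i.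
  have [i c0i] : exists i, c0 0 i != 0.
    by apply/rV0Pn.
  have [lt|gt|/eqP] := ltgtP (c0 0 i) 0; last by rewrite (negbTE c0i).
    exists (- c0); rewrite mulNmx c0M oppr0; split => //; exists i.
    by rewrite mxE oppr_gt0.
  by exists c0; split => //; exists i.
pose B := [set enum_val j | j in [set j | 0 < c 0 j]].
have BA : B \subset A by apply/subsetP => s /imsetP[j _ ->]; exact: enum_valP.
have [h] := HA B BA; rewrite inE => /asboolP[w ->] hB.
have pos j : (0 < dotv w (v (enum_val j))) = (0 < c 0 j).
  move/setP: hB => /(_ (enum_val j)); rewrite !inE enum_valP andbT => ->.
  by rewrite mem_imset ?inE //; exact: enum_val_inj.
have : \sum_j c 0 j * dotv w (v (enum_val j)) = 0.
  transitivity ((c *m M *m w^T) 0 0); last by rewrite cM mul0mx mxE.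
  rewrite -mulmxA mxE; apply: eq_bigr => j _; congr (_ * _).
  by rewrite dotv_sum mxE; apply: eq_bigr => k _; rewrite !mxE mulrC.
(* Coefficients and scalar products are positive at the same indices, so every term is nonnegative
   and the [i]-th is positive. *)
rewrite (bigD1 i) //=; apply/eqP; rewrite gt_eqF // ltr_wpDr //.
  apply: sumr_ge0 => j _; have := pos j.
  have [c0j|cj0] := ltP 0 (c 0 j); first by move=> dj; rewrite mulr_ge0 // ltW.
  by move/negbT; rewrite -leNgt => dj; exact: mulr_le0.
by rewrite mulr_gt0 // pos.
Qed.

(** For |b| <= 1/2, e^b <= 1/(1 - b) <= 1 + b + 2b^2; the linear terms cancel in the mean over a and
    -a. *)
Lemma cosh_le (R : realType) (a : R) : `|a| <= 2^-1 ->
  2^-1 * (expR a + expR (- a)) <= expR (2 * a ^+ 2).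
Proof.
move=> a2.
have up (b : R) : `|b| <= 2^-1 -> expR b <= 1 + b + 2 * b ^+ 2.
  rewrite ler_norml => /andP[b1 b2].
  have := expR_ge1Dx (- b); rewrite expRN => h.
  have e0 := expR_gt0 b.
  have {}h : (1 - b) * expR b <= 1.
    have := ler_wpM2r (ltW e0) h; rewrite mulVf //; exact: lt0r_neq0.
  have : 1 <= (1 - b) * (1 + b + 2 * b ^+ 2) by nra.
  move=> /(le_trans h); rewrite ler_pM2l //; lra.
have := up _ a2; have := up (- a); rewrite normrN sqrrN => /(_ a2) h1 h2.
apply: le_trans (expR_ge1Dx _); lra.
Qed.

(** * Symmetrization for i.i.d. samples from a finite law *)

Section Symmetrization.
Variables (R : realType) (T : finType) (w : T -> R) (n : nat).
Hypotheses (w_ge0 : forall s, 0 <= w s) (w_sum1 : \sum_s w s = 1).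
Implicit Types (u v : {ffun 'I_n -> T}) (h : {set T}) (e : {ffun 'I_n -> bool}).

Definition iid_weight u : R := \prod_i w (u i).

Definition emp u h : R := n%:R^-1 * \sum_i (u i \in h)%:R.

Lemma iid_weight_ge0 u : 0 <= iid_weight u.
Proof. exact: prodr_ge0. Qed.

Lemma sum_iid_weight : \sum_u iid_weight u = 1.
Proof.
rewrite /iid_weight -(bigA_distr_bigA (fun=> w)) /=.
by rewrite big1 // => i _.
Qed.

Lemma iid_weight_coord (i : 'I_n) (g : T -> R) :
  \sum_u iid_weight u * g (u i) = \sum_s w s * g s.
Proof.
pose F (j : 'I_n) (s : T) := if j == i then w s * g s else w s.
transitivity (\sum_(u : {ffun 'I_n -> T}) \prod_j F j (u j)).
  apply: eq_bigr => u _; rewrite /iid_weight (bigD1 i) //= [RHS](bigD1 i) //=.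
  rewrite {1}/F eqxx mulrAC; congr (_ * _).
  by apply: eq_bigr => j /negbTE ji; rewrite /F ji.
rewrite -bigA_distr_bigA /= (bigD1 i) //= {1}/F eqxx.
rewrite [X in _ * X]big1 ?mulr1 // => j /negbTE ji.
by rewrite -[RHS]w_sum1; apply: eq_bigr => s _; rewrite /F ji.
Qed.

Lemma iid_weight_emp h : (0 < n)%N ->
  \sum_u iid_weight u * emp u h = \sum_s w s * (s \in h)%:R.
Proof.
move=> n0; rewrite /emp.
under eq_bigr do rewrite mulrCA mulr_sumr.
rewrite -mulr_sumr exchange_big /=.
under eq_bigr do rewrite (iid_weight_coord _ (fun s => (s \in h)%:R)).
rewrite sumr_const card_ord -[X in _ * X]mulr_natl mulrA mulVf ?mul1r //.
by rewrite pnatr_eq0 -lt0n.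
Qed.

(** A pair consists of a sample and a ghost sample; their entries at [i] are exchanged exactly when
    [e i] is false. *)
Definition swap e (p : {ffun 'I_n -> T} * {ffun 'I_n -> T}) :=
  ([ffun i => if e i then p.1 i else p.2 i],
   [ffun i => if e i then p.2 i else p.1 i]).

Lemma swapK e : involutive (swap e).
Proof.
move=> [u v]; rewrite /swap /=; congr pair; apply/ffunP => i;
  by rewrite !ffunE /=; case: (e i).
Qed.

Lemma swap_weight e p :
  iid_weight (swap e p).1 * iid_weight (swap e p).2 =
  iid_weight p.1 * iid_weight p.2.
Proof.
rewrite /iid_weight -!big_split /=; apply: eq_bigr => i _.
by rewrite !ffunE; case: (e i) => //; rewrite mulrC.
Qed.

Definition sample (p : {ffun 'I_n -> T} * {ffun 'I_n -> T}) : {set T} :=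
  [set p.1 i | i in 'I_n] :|: [set p.2 i | i in 'I_n].

Lemma card_sample p : (#|sample p| <= 2 * n)%N.
Proof.
rewrite /sample cardsU (leq_trans (leq_subr _ _)) // mul2n -addnn.
by apply: leq_add; apply: leq_trans (leq_imset_card _ _) _; rewrite card_ord.
Qed.

Lemma sample_swap e p : sample (swap e p) = sample p.
Proof.
suff sub q : sample (swap e q) \subset sample q.
  by apply/eqP; rewrite eqEsubset sub /= -{1}[p](swapK e) sub.
apply/subsetP => s; rewrite !inE => /orP[] /imsetP[i _ ->]; rewrite ffunE;
  by case: (e i); rewrite ?imset_f ?orbT.
Qed.

(** The mean over independent signs factorises over the coordinates, each factor being a hyperbolic
    cosine. *)
Lemma sum_sign_expR (a : 'I_n -> R) : (forall i, `|a i| <= 2^-1) ->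
  2^-1 ^+ n * \sum_(e : {ffun 'I_n -> bool}) expR (\sum_i (-1) ^+ e i * a i) <=
  expR (2 * \sum_i a i ^+ 2).
Proof.
move=> ha; under eq_bigr do rewrite expR_sum.
rewrite -(bigA_distr_bigA (fun i (b : bool) => expR ((-1) ^+ b * a i))) /=.
under eq_bigr do rewrite big_bool /= expr1 expr0 mulN1r mul1r.
have -> : 2^-1 ^+ n = \prod_(i < n) 2^-1 :> R by rewrite prodr_const card_ord.
rewrite -big_split mulr_sumr expR_sum /=; apply: ler_prod => i _.
rewrite [X in _ * X]addrC cosh_le // andbT.
by rewrite mulr_ge0 ?invr_ge0 // addr_ge0 // expR_ge0.
Qed.

(** The sum over traces serves as a union bound: it is finite, dominates each of its terms, and
    ranges over a family that [swap] leaves unchanged. *)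
Definition exp_gap (H : {set {set T}}) (l : R) p : R :=
  \sum_(B in traces H (sample p)) expR (l * (emp p.2 B - emp p.1 B)).

Lemma emp_swap e p h :
  emp (swap e p).2 h - emp (swap e p).1 h =
  \sum_i (-1) ^+ e i * (n%:R^-1 * ((p.1 i \in h)%:R - (p.2 i \in h)%:R)).
Proof.
rewrite /emp -mulrBr -sumrB mulr_sumr; apply: eq_bigr => i _.
by rewrite !ffunE; case: (e i); rewrite ?expr1 ?expr0; ring.
Qed.

(** The traces do not depend on the swap, so the sign average applies to each trace separately, with
    coefficients at most l/n <= 1/2 in absolute value. *)
Lemma sign_exp_gap_le (H : {set {set T}}) (G l : R) p :
  (0 < n)%N -> 0 <= l -> l <= n%:R / 2 ->
  #|traces H (sample p)|%:R <= G ->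
  2^-1 ^+ n * \sum_e exp_gap H l (swap e p) <= G * expR (2 * l ^+ 2 / n%:R).
Proof.
move=> n0 l0 ln HG; have nR0 : 0 < n%:R :> R by rewrite ltr0n.
have b1 (a b : bool) : `|a%:R - b%:R : R| <= 1.
  by case: a; case: b; rewrite ?subrr ?subr0 ?sub0r ?normrN ?normr0 ?normr1.
rewrite /exp_gap; under eq_bigr do rewrite sample_swap.
rewrite exchange_big /= mulr_sumr.
apply: (@le_trans _ _ (\sum_(B in traces H (sample p)) expR (2 * l ^+ 2 / n%:R)));
  last by rewrite sumr_const -[leLHS]mulr_natl ler_wpM2r ?expR_ge0.
apply: ler_sum => B _.
pose a i : R := l * (n%:R^-1 * ((p.1 i \in B)%:R - (p.2 i \in B)%:R)).
have ha i : `|a i| <= l / n%:R.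
  rewrite /a !normrM (ger0_norm l0) ger0_norm ?invr_ge0 ?ler0n //.
  by rewrite mulrA ler_piMr // divr_ge0 // ler0n.
have l2 : l / n%:R <= 2^-1 by rewrite ler_pdivrMr // mulrC.
under eq_bigr => e _.
  rewrite emp_swap mulr_sumr.
  under eq_bigr do rewrite mulrCA.
  over.
rewrite -/a.
apply: (le_trans (sum_sign_expR _)); first by move=> i; exact: le_trans (ha i) l2.
rewrite ler_expR -mulrA ler_pM2l //.
apply: (@le_trans _ _ (\sum_(i < n) (l / n%:R) ^+ 2)).
  apply: ler_sum => i _; rewrite -[a i ^+ 2]real_normK ?num_real //.
  by rewrite lerXn2r // ?nnegrE // divr_ge0 // ler0n.
rewrite sumr_const card_ord -[leLHS]mulr_natl expr_div_n [n%:R ^+ 2]expr2.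
apply: ler_eq; field; exact: lt0r_neq0.
Qed.

(* Symmetrization: e^x >= 1 + x replaces the mean over v by an exponential
   moment, and swapping the entries of the two samples u, v leaves their joint
   law unchanged. *)
Lemma deviation_prob_le (H : {set {set T}}) (G eps : R) :
  (0 < n)%N -> 0 <= eps -> eps <= 2 ->
  (forall X : {set T}, (#|X| <= 2 * n)%N -> #|traces H X|%:R <= G) ->
  \sum_(u | [exists h in H, eps < \sum_s w s * (s \in h)%:R - emp u h])
     iid_weight u <= G * expR (- (n%:R * eps ^+ 2 / 8)).
Proof.
move=> n0 e0 e2 HG; have nR0 : 0 < n%:R :> R by rewrite ltr0n.
(* This [l] minimises 2 l^2 / n - l eps, with minimum - n eps^2 / 8; [eps <= 2] ensures l <= n/2. *)
pose l := n%:R * eps / 4.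
have l0 : 0 <= l by rewrite /l divr_ge0 // mulr_ge0 // ler0n.
have ln : l <= n%:R / 2 by rewrite /l; nra.
pose W p := iid_weight p.1 * iid_weight p.2.
have W0 p : 0 <= W p by rewrite mulr_ge0 // iid_weight_ge0.
have main : \sum_p W p * exp_gap H l p <= G * expR (2 * l ^+ 2 / n%:R).
  have -> : \sum_p W p * exp_gap H l p =
      2^-1 ^+ n * \sum_e \sum_p W p * exp_gap H l (swap e p).
    rewrite [X in _ * X](eq_bigr (fun=> \sum_p W p * exp_gap H l p)); last first.
      move=> e _; rewrite [RHS](reindex_inj (inv_inj (swapK e))) /=.
      by apply: eq_bigr => p _; rewrite /W swap_weight.
    rewrite sumr_const card_ffun card_bool card_ord -[X in _ = _ * X]mulr_natl natrX.
    by rewrite mulrA -exprMn mulVf ?expr1n ?mul1r // pnatr_eq0.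
  rewrite exchange_big /= mulr_sumr.
  have W1 : \sum_p W p = 1.
    rewrite -(pair_bigA _ (fun u v => iid_weight u * iid_weight v)) /=.
    by under eq_bigr do rewrite -mulr_sumr sum_iid_weight mulr1; rewrite sum_iid_weight.
  set K := G * _.
  rewrite (_ : K = \sum_p W p * K); last by rewrite -mulr_suml W1 mul1r.
  apply: ler_sum => p _.
  rewrite -mulr_sumr mulrCA ler_wpM2l //; apply: sign_exp_gap_le => //.
  by apply: HG; exact: card_sample.
have -> : G * expR (- (n%:R * eps ^+ 2 / 8)) =
    expR (- (l * eps)) * (G * expR (2 * l ^+ 2 / n%:R)).
  rewrite [RHS]mulrCA -expRD; congr (_ * expR _); rewrite /l; field.
  exact: lt0r_neq0.
apply: le_trans (ler_wpM2l (expR_ge0 _) main).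
rewrite -(pair_bigA _ (fun u v => W (u, v) * exp_gap H l (u, v))) /=.
rewrite mulr_sumr big_mkcond /=; apply: ler_sum => u _.
have gap_ge0 p : 0 <= exp_gap H l p by apply: sumr_ge0 => B _; exact: expR_ge0.
case: ifP => [/exists_inP[h hH bad]|_]; last first.
  by rewrite mulr_ge0 ?expR_ge0 // sumr_ge0 // => v _; rewrite mulr_ge0.
under eq_bigr do rewrite /W -mulrA /=.
rewrite -mulr_sumr mulrCA -[leLHS]mulr1 ler_wpM2l ?iid_weight_ge0 //.
set P := \sum_s w s * (s \in h)%:R in bad.
apply: (@le_trans _ _ (expR (- (l * eps)) * expR (l * (P - emp u h)))).
  rewrite -expRD -expR0 ler_expR addrC subr_ge0; apply: ler_wpM2l => //.
  exact: ltW.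
rewrite ler_pM2l ?expR_gt0 //.
apply: (@le_trans _ _ (\sum_v iid_weight v * expR (l * (emp v h - emp u h)))).
  (* Jensen's inequality in [v]: the tangent to the exponential at l (P - emp u h) is averaged, and
     its linear part vanishes because [emp v h] has mean [P]. *)
  have tangent x y : expR x * (1 + (y - x)) <= expR y :> R.
    have -> : expR y = expR x * expR (y - x) by rewrite -expRD addrC subrK.
    by rewrite ler_pM2l ?expR_gt0 // expR_ge1Dx.
  apply: (@le_trans _ _ (\sum_v iid_weight v * (expR (l * (P - emp u h)) *
     (1 + (l * (emp v h - emp u h) - l * (P - emp u h)))))).
    under eq_bigr => v _.
      rewrite (_ : _ * _ = expR (l * (P - emp u h)) * (1 - l * P) * iid_weight v
        + expR (l * (P - emp u h)) * l * (iid_weight v * emp v h)); last by ring.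
      over.
    rewrite big_split /= -!mulr_sumr sum_iid_weight iid_weight_emp // -/P.
    by apply: ler_eq; ring.
  by apply: ler_sum => v _; rewrite ler_wpM2l ?iid_weight_ge0.
apply: ler_sum => v _; rewrite ler_wpM2l ?iid_weight_ge0 // /exp_gap.
(* The trace of [h] on the joint sample has the same frequencies as [h]; the other terms of
   [exp_gap] are nonnegative. *)
rewrite (bigD1 (h :&: sample (u, v))) /=; last by apply/imsetP; exists h.
have empI (z : {ffun 'I_n -> T}) : (forall i, z i \in sample (u, v)) ->
    emp z (h :&: sample (u, v)) = emp z h.
  by move=> zi; congr (_ * _); apply: eq_bigr => i _; rewrite inE zi andbT.
have -> : emp v (h :&: sample (u, v)) = emp v h.
  by apply: empI => i; apply/setUP; right; apply/imsetP; exists i.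
have -> : emp u (h :&: sample (u, v)) = emp u h.
  by apply: empI => i; apply/setUP; left; apply/imsetP; exists i.
by rewrite lerDl sumr_ge0 // => B _; exact: expR_ge0.
Qed.

End Symmetrization.

(** * Elementary inequalities and the logistic risk *)

(** The weights [c] may be negative, so [g] is peeled by layers: if [v] is its least positive value,
    the bottom layer contributes [v] times the [c]-mass of the support, and the rest is at most
    [M - v] with smaller support. *)
Lemma layer_cake_le (R : realFieldType) (T : finType) (c g : T -> R) (eps M : R) :
  0 <= eps -> 0 <= M -> (forall s, 0 <= g s <= M) ->
  (forall t, 0 <= t -> \sum_(s | t < g s) c s <= eps) ->
  \sum_s c s * g s <= M * eps.
Proof.
move=> e0; have [k] := ubnP #|[pred s | 0 < g s]|.
elim: k g M => // k IH g M; rewrite ltnS => gk M0 gM ge.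
case: (pickP [pred s | 0 < g s]) => [s1 s1g|g0]; last first.
  rewrite big1 ?mulr_ge0 // => s _.
  have := g0 s; rewrite /= lt_neqAle (andP (gM s)).1 andbT => /negbFE/eqP <-.
  by rewrite mulr0.
case: (arg_minP g s1g) => s0 s0g gmin; set v := g s0 in gmin.
have v0 : 0 < g s0 by [].
pose g' s := if 0 < g s then g s - v else 0.
have -> : \sum_s c s * g s = v * \sum_(s | 0 < g s) c s + \sum_s c s * g' s.
  rewrite mulr_sumr [X in X + _]big_mkcond -big_split /=; apply: eq_bigr => s _.
  rewrite /g'; case: ifP => [_|/negbT]; first by ring.
  rewrite -leNgt => gs; suff -> : g s = 0 by ring.
  by apply/eqP; rewrite eq_le gs (andP (gM s)).1.
have -> : M * eps = v * eps + (M - v) * eps by ring.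
apply: lerD; first by rewrite ler_pM2l // ge.
apply: IH.
- apply: leq_trans gk; apply/proper_card/properP; split.
    apply/subsetP => s; rewrite !inE /g'; case: ifP => //.
    by rewrite ltxx.
  by exists s0 => //; rewrite inE /g' v0 subrr ltxx.
- by rewrite subr_ge0; case/andP: (gM s0).
- move=> s; rewrite /g'; case: ifP => [gs|_].
    by rewrite subr_ge0 gmin //= lerB //; case/andP: (gM s).
  by rewrite lexx subr_ge0; case/andP: (gM s0).
(* The level set of [g'] at [t] is that of [g] at [t + v]. *)
- move=> t t0; apply: le_trans (ge (t + v) _); last by rewrite addr_ge0 // ltW.
  apply: ler_eq; apply: eq_bigl => s; rewrite /g'; case: ifP => [gs|/negbT].
    by rewrite ltrBrDr.
  rewrite -leNgt => gs; rewrite !ltNge t0 (le_trans gs) //.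
  by rewrite addr_ge0 // ltW.
Qed.

(** * Scalar product and Euclidean norm *)

Lemma dotvC (R : realType) (d : nat) (u v : 'rV[R]_d) : dotv u v = dotv v u.
Proof. by rewrite !dotv_sum; apply: eq_bigr => j _; rewrite mulrC. Qed.

Lemma dotvZr (R : realType) (d : nat) (u v : 'rV[R]_d) (a : R) :
  dotv u (a *: v) = a * dotv u v.
Proof. by rewrite /dotv linearZ /= -scalemxAr mxE. Qed.

Lemma dotvDr (R : realType) (d : nat) (u v w : 'rV[R]_d) :
  dotv u (v + w) = dotv u v + dotv u w.
Proof. by rewrite /dotv linearD /= mulmxDr mxE. Qed.

Lemma dotv_sumr (R : realType) (d : nat) (I : Type) (s : seq I) (P : pred I)
    (u : 'rV[R]_d) (F : I -> 'rV[R]_d) :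
  dotv u (\sum_(i <- s | P i) F i) = \sum_(i <- s | P i) dotv u (F i).
Proof. by rewrite /dotv linear_sum /= mulmx_sumr summxE. Qed.

Lemma dotvv_ge0 (R : realType) (d : nat) (u : 'rV[R]_d) : 0 <= dotv u u.
Proof. by rewrite dotv_sum sumr_ge0 // => j _; rewrite -expr2 sqr_ge0. Qed.

Lemma norm2_ge0 (R : realType) (d : nat) (u : 'rV[R]_d) : 0 <= norm2 u.
Proof. exact: sqrtr_ge0. Qed.

Lemma sqr_norm2 (R : realType) (d : nat) (u : 'rV[R]_d) :
  norm2 u ^+ 2 = dotv u u.
Proof. by rewrite sqr_sqrtr // dotvv_ge0. Qed.

Lemma norm2_eq0 (R : realType) (d : nat) (u : 'rV[R]_d) : norm2 u = 0 -> u = 0.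
Proof.
move=> u0; have /eqP : dotv u u = 0 by rewrite -sqr_norm2 u0 expr0n.
rewrite dotv_sum psumr_eq0 => [/allP h|j _]; last by rewrite -expr2 sqr_ge0.
apply/rowP => j; rewrite mxE; have := h j; rewrite mem_index_enum => /(_ isT).
by rewrite -expr2 sqrf_eq0 => /eqP.
Qed.

Lemma dotv_le_norm2 (R : realType) (d : nat) (u v : 'rV[R]_d) :
  dotv u v <= norm2 u * norm2 v.
Proof.
have [u0|un] := eqVneq (norm2 u) 0.
  by rewrite (norm2_eq0 u0) {1}/dotv mul0mx mxE mulr_ge0 ?norm2_ge0.
have [v0|vn] := eqVneq (norm2 v) 0.
  by rewrite (norm2_eq0 v0) {1}/dotv linear0 mulmx0 mxE mulr_ge0 ?norm2_ge0.
set a := norm2 u in un *; set b := norm2 v in vn *.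
have ab : 0 < a * b by rewrite mulr_gt0 // lt_neqAle eq_sym ?un ?vn norm2_ge0.
(* With a = |u| and b = |v|, expanding |b u - a v|^2 >= 0 gives 2ab (ab - u.v) >= 0. *)
have := dotvv_ge0 (b *: u + (- a) *: v).
rewrite !(dotvDr, dotvZr) ![dotv (_ + _) _]dotvC !(dotvDr, dotvZr).
rewrite -!sqr_norm2 [dotv v u]dotvC -/a -/b => h.
rewrite -subr_ge0 -(pmulr_rge0 _ ab); lra.
Qed.

Lemma norm2Z (R : realType) (d : nat) (u : 'rV[R]_d) (a : R) : 0 <= a ->
  norm2 (a *: u) = a * norm2 u.
Proof.
move=> a0; rewrite /norm2 dotvZr dotvC dotvZr mulrA sqrtrM ?mulr_ge0 //.
by rewrite -expr2 sqrtr_sqr ger0_norm.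
Qed.

Lemma ln_prod (R : realType) (I : Type) (s : seq I) (F : I -> R) :
  (forall i, 0 < F i) -> ln (\prod_(i <- s) F i) = \sum_(i <- s) ln (F i).
Proof.
move=> F0; rewrite -[RHS]expRK expR_sum; congr ln.
by apply: eq_bigr => i _; rewrite lnK // posrE.
Qed.

Lemma sum_expR_gt0 (R : realType) (I : finType) (A : {set I}) (a : I -> R) :
  (0 < #|A|)%N -> 0 < \sum_(s in A) expR (a s).
Proof.
rewrite card_gt0 => /set0Pn[s sA]; rewrite (bigD1 s) //= ltr_wpDr ?expR_gt0 //.
by apply: sumr_ge0 => i _; exact: expR_ge0.
Qed.

(** Jensen's inequality: e^(a_s - L) >= 1 + (a_s - L) is summed over [A], the left side giving |A|
    by the choice of [L]. *)
Lemma mean_le_ln_mean_expR (R : realType) (I : finType) (A : {set I})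
    (a : I -> R) : (0 < #|A|)%N ->
  #|A|%:R^-1 * \sum_(s in A) a s <= ln (#|A|%:R^-1 * \sum_(s in A) expR (a s)).
Proof.
move=> A0; set Z := \sum_(s in A) expR (a s); set L := ln _.
have N0 : 0 < #|A|%:R :> R by rewrite ltr0n.
have Z0 : 0 < Z by exact: sum_expR_gt0.
have eL : expR L = #|A|%:R^-1 * Z by rewrite lnK // posrE mulr_gt0 // invr_gt0.
have : \sum_(s in A) (1 + (a s - L)) <= \sum_(s in A) expR (a s - L).
  by apply: ler_sum => s _; exact: expR_ge1Dx.
under [X in _ <= X -> _]eq_bigr do rewrite expRD.
rewrite -mulr_suml -/Z expRN eL invfM invrK mulrCA divff ?lt0r_neq0 // mulr1.
rewrite big_split /= sumrB !sumr_const -[L *+ _]mulr_natl => h.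
by rewrite mulrC ler_pdivrMr // mulrC; lra.
Qed.

(* Nonnegativity of the relative entropy of the Gibbs weights expR (a s) / Z
   with respect to the uniform law on A. *)
Lemma ln_mean_expR_le (R : realType) (I : finType) (A : {set I})
    (a : I -> R) : (0 < #|A|)%N ->
  ln (#|A|%:R^-1 * \sum_(s in A) expR (a s)) <=
  (\sum_(s in A) a s * expR (a s)) / \sum_(s in A) expR (a s).
Proof.
move=> A0; set Z := \sum_(s in A) expR (a s); set L := ln _.
have N0 : 0 < #|A|%:R :> R by rewrite ltr0n.
have Z0 : 0 < Z by exact: sum_expR_gt0.
have eL : expR L = #|A|%:R^-1 * Z by rewrite lnK // posrE mulr_gt0 // invr_gt0.
have : \sum_(s in A) expR (a s) * (1 + (L - a s)) <= \sum_(s in A) expR L.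
  apply: ler_sum => s _; have -> : expR L = expR (a s) * expR (L - a s).
    by rewrite -expRD addrC subrK.
  by rewrite ler_pM2l ?expR_gt0 // expR_ge1Dx.
rewrite sumr_const -[expR L *+ _]mulr_natl eL mulVKf ?lt0r_neq0 //.
rewrite (eq_bigr (fun s => (1 + L) * expR (a s) - a s * expR (a s))); last first.
  by move=> s _; ring.
rewrite sumrB -mulr_sumr -/Z ler_pdivlMr // => h; lra.
Qed.

Lemma exp_rado_risk_enum (R : realType) (m d : nat) (x : 'I_m -> 'rV[R]_d)
    (y : signature m) (A : {set signature m}) (theta : 'rV[R]_d) :
  exp_rado_risk x y (enum A) theta =
  #|A|%:R^-1 * \sum_(s in A) expR (- dotv theta (rado x y s)).
Proof. by rewrite /exp_rado_risk -cardE big_enum. Qed.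

Lemma exp_rado_risk_gt0 (R : realType) (m d : nat) (x : 'I_m -> 'rV[R]_d)
    (y : signature m) (A : {set signature m}) (theta : 'rV[R]_d) :
  (0 < #|A|)%N -> 0 < exp_rado_risk x y (enum A) theta.
Proof.
by move=> A0; rewrite exp_rado_risk_enum mulr_gt0 ?invr_gt0 ?ltr0n ?sum_expR_gt0.
Qed.

Lemma card_signature_gt0 (m : nat) : (0 < #|[set: signature m]%SET|)%N.
Proof. by rewrite cardsT card_ffun card_bool expn_gt0. Qed.

(* The sum over all signatures factorises: the i-th factor is 1 for s i <> y i
   and the logistic exponential for s i = y i. *)
Lemma log_risk_rado (R : realType) (m d : nat) (x : 'I_m -> 'rV[R]_d)
    (y : signature m) (theta : 'rV[R]_d) : (0 < m)%N ->
  log_risk x y theta =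
  log_rado_risk x y (enum [set: signature m]%SET) theta.
Proof.
move=> m0; rewrite /log_rado_risk exp_rado_risk_enum.
pose F (i : 'I_m) (b : bool) : R :=
  expR (- (2^-1 * ((pm1 R b + pm1 R (y i)) * dotv theta (x i)))).
have sumE : \sum_(s : {ffun 'I_m -> bool}) expR (- dotv theta (rado x y s)) =
    \prod_i (1 + expR (- (pm1 R (y i) * dotv theta (x i)))).
  rewrite (eq_bigr (fun s : {ffun 'I_m -> bool} => \prod_i F i (s i))); last first.
    move=> s _; rewrite /rado dotvZr dotv_sumr mulr_sumr -sumrN expR_sum.
    by apply: eq_bigr => i _; rewrite dotvZr.
  rewrite -(bigA_distr_bigA F) /=; apply: eq_bigr => i _; rewrite big_bool /F /pm1.
  case: (y i); rewrite ?subrr ?addNr mul0r mulr0 oppr0 expR0 /=.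
    by rewrite [RHS]addrC; congr (expR _ + _); field.
  by congr (_ + expR _); field.
rewrite (eq_bigl xpredT) => [|s]; last by rewrite inE.
rewrite {}sumE.
have m0R : m%:R != 0 :> R by rewrite pnatr_eq0 -lt0n.
have pos i : 0 < 1 + expR (- (pm1 R (y i) * dotv theta (x i))).
  by rewrite addr_gt0 // expR_gt0.
rewrite cardsT card_ffun card_bool card_ord lnM ?posrE ?invr_gt0 ?ltr0n ?expn_gt0 //;
  last by apply: prodr_gt0.
rewrite lnV ?posrE ?ltr0n ?expn_gt0 // natrX lnXn // -[ln _ *+ _]mulr_natl.
rewrite ln_prod // /log_risk mulrDr mulrN mulKf //; ring.
Qed.

(** * The bound on Q *)

Lemma is_derive_sum_seq (R : realType) (I : Type) (r : seq I)
    (F : I -> R -> R) (dF : I -> R) (t : R) :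
  (forall i, is_derive t 1 (F i) (dF i)) ->
  is_derive t 1 (fun h => \sum_(i <- r) F i h) (\sum_(i <- r) dF i).
Proof.
move=> dFi; elim: r => [|i r IH].
  rewrite big_nil (_ : (fun _ => _) = cst 0); first exact: is_derive_cst.
  by apply/funext => h; rewrite big_nil.
rewrite big_cons (_ : (fun _ => _) = F i + (fun h => \sum_(j <- r) F j h)).
  exact: is_deriveD.
by apply/funext => h; rewrite big_cons.
Qed.

(** The chain rule along a line; the factor [c], later 1/|A|, cancels in the logarithmic
    derivative. *)
Lemma is_derive_ln_sum_expR (R : realType) (I : Type) (r : seq I)
    (a b : I -> R) (c : R) :
  0 < c -> 0 < \sum_(i <- r) expR (a i) ->
  is_derive (0 : R) 1 (fun h => ln (c * \sum_(i <- r) expR (a i + h * b i)))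
    ((\sum_(i <- r) b i * expR (a i)) / \sum_(i <- r) expR (a i)).
Proof.
move=> c0 Z0; set Z := \sum_(i <- r) expR (a i) in Z0 *.
pose g h := c * \sum_(i <- r) expR (a i + h * b i).
have g0 : g 0 = c * Z.
  by congr (_ * _); apply: eq_bigr => i _; rewrite mul0r addr0.
have dg : is_derive (0 : R) 1 g (c * \sum_(i <- r) b i * expR (a i)).
  suff dS : is_derive (0 : R) 1 (fun h => \sum_(i <- r) expR (a i + h * b i))
      (\sum_(i <- r) b i * expR (a i)) by exact: (is_deriveZ c dS).
  apply: is_derive_sum_seq => i.
  rewrite mulrC -{2}[a i]addr0 -{2}(mul0r (b i)).
  apply: (@is_derive1_comp _ expR (fun h => a i + h * b i)).
  rewrite -[X in is_derive _ _ _ X]add0r.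
  apply: is_deriveD; rewrite -[X in is_derive _ _ _ X]mulr1.
  rewrite (_ : (fun h => h * b i) = b i \*: id).
    exact: is_deriveZ.
  by apply/funext => h; rewrite mulrC.
have := @is_derive1_comp R (@ln R) g 0 (g 0)^-1 _ _ dg.
rewrite g0 => dl; apply: (is_derive_eq (dl _)); last first.
  by field; rewrite !lt0r_neq0.
by apply: is_derive1_ln; rewrite mulr_gt0.
Qed.

Lemma derive_line (R : realType) (d : nat) (f : 'rV[R]_d -> R)
    (theta v : 'rV[R]_d) :
  'D_v f theta = 'D_1 (fun h : R => f (theta + h *: v)) 0.
Proof.
rewrite /derive; pose g (h : R) := f (theta + h *: v).
have -> // : (fun h : R => h^-1 *: ((f \o shift theta) (h *: v) - f theta)) =
  fun h : R => h^-1 *: ((g \o shift 0) h%:A - g 0).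
apply/funext => h; rewrite /g /=.
by rewrite addr0 scale0r addr0 [theta + _]addrC [h *: 1]mulr1.
Qed.

Lemma dotv_delta (R : realType) (d : nat) (u : 'rV[R]_d) (j : 'I_d) :
  dotv u (delta_mx 0 j) = u 0 j.
Proof.
rewrite dotv_sum (bigD1 j) //= mxE !eqxx mulr1 big1 ?addr0 // => k kj.
by rewrite mxE (negbTE kj) andbF mulr0.
Qed.

Lemma grad_log_rado_risk (R : realType) (m d : nat) (x : 'I_m -> 'rV[R]_d)
    (y : signature m) (A : {set signature m}) (theta : 'rV[R]_d) (j : 'I_d) :
  (0 < #|A|)%N ->
  grad (log_rado_risk x y (enum A)) theta 0 j =
  m%:R^-1 *
  ((\sum_(s in A) - rado x y s 0 j * expR (- dotv theta (rado x y s))) /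
   \sum_(s in A) expR (- dotv theta (rado x y s))).
Proof.
move=> A0; rewrite mxE derive_line -!big_enum /=.
pose a s := - dotv theta (rado x y s).
pose b s := - rado x y s 0 j.
have -> : (fun h => log_rado_risk x y (enum A) (theta + h *: delta_mx 0 j)) =
    cst (ln 2) + m%:R^-1 \*: (fun h : R =>
      ln (#|A|%:R^-1 * \sum_(s <- enum A) expR (a s + h * b s))).
  apply/funext => h; rewrite /log_rado_risk /exp_rado_risk -cardE /=.
  congr (_ + _ * ln (_ * _)); apply: eq_bigr => s _; congr expR.
  by rewrite dotvC dotvDr dotvZr dotvC dotv_delta opprD -mulrN.
have dl : is_derive (0 : R) 1
    (fun h => ln (#|A|%:R^-1 * \sum_(s <- enum A) expR (a s + h * b s)))
    ((\sum_(s <- enum A) b s * expR (a s)) / \sum_(s <- enum A) expR (a s)).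
  apply: is_derive_ln_sum_expR; first by rewrite invr_gt0 ltr0n.
  by rewrite big_enum sum_expR_gt0.
by rewrite (@derive_val _ _ _ _ _ _ _ (is_deriveD (is_derive_cst _ _ _)
  (is_deriveZ _ dl))) add0r.
Qed.

(* The convexity inequality f theta - f 0 <= theta . grad f theta for
   f = log_rado_risk, where f 0 = ln 2. *)
Lemma log_rado_risk_le_grad (R : realType) (m d : nat) (x : 'I_m -> 'rV[R]_d)
    (y : signature m) (A : {set signature m}) (theta : 'rV[R]_d) :
  (0 < #|A|)%N ->
  m%:R^-1 * ln (exp_rado_risk x y (enum A) theta) <=
  dotv theta (grad (log_rado_risk x y (enum A)) theta).
Proof.
move=> A0; rewrite exp_rado_risk_enum.
have -> : dotv theta (grad (log_rado_risk x y (enum A)) theta) =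
  m%:R^-1 * ((\sum_(s in A) - dotv theta (rado x y s) *
                 expR (- dotv theta (rado x y s))) /
             \sum_(s in A) expR (- dotv theta (rado x y s))).
  rewrite dotv_sum.
  under eq_bigr do rewrite grad_log_rado_risk // mulrCA [_ * (_ / _)]mulrA.
  rewrite -mulr_sumr -mulr_suml; congr (_ * (_ / _)).
  under eq_bigr do rewrite mulr_sumr.
  rewrite exchange_big /=; apply: eq_bigr => s _.
  rewrite dotv_sum -sumrN mulr_suml; apply: eq_bigr => j _; ring.
rewrite ler_wpM2l ?invr_ge0 ?ler0n //; exact: ln_mean_expR_le.
Qed.

Lemma bigQE (R : realType) (m d : nat) (x : 'I_m -> 'rV[R]_d)
    (y : signature m) (A : {set signature m}) (theta : 'rV[R]_d) :
  (0 < #|A|)%N ->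
  bigQ x y A theta =
  m%:R^-1 * ln (exp_rado_risk x y (enum [set: signature m]%SET) theta) -
  m%:R^-1 * ln (exp_rado_risk x y (enum A) theta).
Proof.
move=> A0; rewrite /bigQ /varrho' lnM ?posrE ?invr_gt0 ?exp_rado_risk_gt0
  ?card_signature_gt0 //.
by rewrite lnV ?posrE ?exp_rado_risk_gt0 ?card_signature_gt0 //; ring.
Qed.

Lemma dotv_le_radius (R : realType) (d : nat) (theta v : 'rV[R]_d) (r : R) :
  norm2 theta < r -> dotv theta v <= r * norm2 v.
Proof.
move=> /ltW tr; apply: le_trans (dotv_le_norm2 _ _) _.
by rewrite ler_wpM2r ?norm2_ge0.
Qed.

Lemma bigQ_le (R : realType) (m d : nat) (x : 'I_m -> 'rV[R]_d)
    (y : signature m) (A : {set signature m}) (theta : 'rV[R]_d) (r : R) :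
  (0 < #|A|)%N -> norm2 theta < r ->
  bigQ x y A theta <=
  r * (norm2 (grad (log_rado_risk x y (enum [set: signature m]%SET)) theta)
       + norm2 (mean_scaled_rado x y A)).
Proof.
move=> A0 tr; rewrite bigQE // mulrDr; apply: lerD.
  apply: le_trans (log_rado_risk_le_grad _ _ _ (card_signature_gt0 m)) _.
  exact: dotv_le_radius.
apply: (@le_trans _ _ (dotv theta (mean_scaled_rado x y A)));
  last exact: dotv_le_radius.
rewrite lerNl exp_rado_risk_enum.
have -> : - dotv theta (mean_scaled_rado x y A) =
    m%:R^-1 * (#|A|%:R^-1 * \sum_(s in A) - dotv theta (rado x y s)).
  rewrite /mean_scaled_rado dotvZr dotv_sumr sumrN !mulrN [in RHS]mulrCA.
  congr (- (_ * _)); rewrite mulr_sumr; apply: eq_bigr => s _.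
  exact: dotvZr.
by rewrite ler_wpM2l ?invr_ge0 ?ler0n // mean_le_ln_mean_expR.
Qed.

Lemma bigQ_setT (R : realType) (m d : nat) (x : 'I_m -> 'rV[R]_d)
    (y : signature m) (theta : 'rV[R]_d) :
  bigQ x y [set: signature m]%SET theta = 0.
Proof. by rewrite bigQE ?card_signature_gt0 // subrr. Qed.

(** * Deviation of exponential risks *)

Lemma dotv_row_mx (R : realType) (k d : nat) (a c : 'rV[R]_k) (u v : 'rV[R]_d) :
  dotv (row_mx a u) (row_mx c v) = dotv a c + dotv u v.
Proof. by rewrite /dotv tr_row_mx mul_row_col mxE. Qed.

(** A constant coordinate 1 turns affine half-spaces of R^d into linear ones of R^(d+1), whence at
    most d + 1 shattered points. *)
Definition affine_halfspaces (R : realType) (T : finType) (d : nat)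
    (v : T -> 'rV[R]_d) : {set {set T}} :=
  halfspaces (fun s => row_mx (const_mx 1 : 'rV[R]_1) (v s)).

Lemma expR_level_halfspace (R : realType) (T : finType) (d : nat)
    (v : T -> 'rV[R]_d) (theta : 'rV[R]_d) (t : R) : 0 <= t ->
  [set s | t < expR (dotv theta (v s))] \in affine_halfspaces v.
Proof.
rewrite le_eqVlt inE => /orP[/eqP <-|t0]; apply/asboolP.
  (* At level 0 the set is everything: zero direction and offset 1. *)
  exists (row_mx (const_mx 1) 0); apply/setP => s; rewrite !inE dotv_row_mx expR_gt0.
  rewrite !dotv_sum big_ord1 !mxE mulr1 big1 ?addr0 ?ltr01 // => j _.
  by rewrite mxE mul0r.
exists (row_mx (const_mx (- ln t)) theta); apply/setP => s.
rewrite !inE dotv_row_mx [dotv (const_mx _) _]dotv_sum big_ord1 !mxE mulr1.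
by rewrite addrC subr_gt0 -{1}[t]lnK ?posrE // ltr_expR.
Qed.

Lemma card_traces_affine (R : realType) (T : finType) (d n : nat)
    (v : T -> 'rV[R]_d) (X : {set T}) :
  (0 < d)%N -> (d <= 2 * n)%N -> (#|X| <= 2 * n)%N ->
  #|traces (affine_halfspaces v) X|%:R <=
  expR (2 * d%:R * ln (2 * expR 1 * n%:R / d%:R)) :> R.
Proof.
move=> d0 dn Xn; have dR : 0 < d%:R :> R by rewrite ltr0n.
have n0 : 0 < n%:R :> R.
  by rewrite ltr0n -(ltn_pmul2l (ltn0Sn 1)) muln0 (leq_trans d0).
have dnR : d%:R <= 2 * n%:R :> R by rewrite -natrM ler_nat.
(* For this t, (1 + t)^(2n) is at most e^d; since d >= 1 and ln t <= 0, the exponent d - (d + 1) ln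
   t is at most 2d (1 - ln t). *)
pose t : R := d%:R / (2 * n%:R).
have t0 : 0 < t by rewrite divr_gt0 // mulr_gt0.
have t1 : t <= 1 by rewrite ler_pdivrMr ?mulr_gt0 // mul1r.
have lnE : ln (2 * expR 1 * n%:R / d%:R) = 1 - ln t.
  have -> : 2 * expR 1 * n%:R / d%:R = expR 1 * t^-1.
    by rewrite /t; field; rewrite !lt0r_neq0.
  by rewrite lnM ?posrE ?expR_gt0 ?invr_gt0 // lnV ?posrE // expRK.
have lt0 : ln t <= 0 by exact: ln_le0.
have := @card_traces_expr R T (affine_halfspaces v) _ X t
  (@halfspaces_shatters _ _ _ _) t0 t1.
rewrite -{1}[t]lnK ?posrE // -expRM_natl.
rewrite -ler_pdivlMr ?expR_gt0 // -expRN => h; apply: (le_trans h).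
apply: (@le_trans _ _ (expR (#|X|%:R * t) * expR (- ((1 + d)%:R * ln t)))).
  rewrite ler_wpM2r ?expR_ge0 // expRM_natl; apply: lerXn2r; rewrite ?nnegrE.
  - by rewrite addr_ge0 // ltW.
  - exact: expR_ge0.
  - exact: expR_ge1Dx.
rewrite -expRD ler_expR lnE natrD.
have Xt : #|X|%:R * t <= d%:R.
  apply: (@le_trans _ _ ((2 * n)%:R * t)); first by rewrite ler_wpM2r ?ler_nat // ltW.
  by rewrite natrM /t mulrC divfK // lt0r_neq0 ?mulr_gt0.
have d1 : 1 <= d%:R :> R by rewrite ler1n.
nra.
Qed.

(** The layer-cake bound is applied to the signed measure [c], the law [w] minus the empirical one.
    [M] bounds the exponentials on the support of [w] only. *)
Lemma exp_risk_deviation (R : realType) (T : finType) (d n : nat)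
    (v : T -> 'rV[R]_d) (w : T -> R) (u : {ffun 'I_n -> T}) (theta : 'rV[R]_d)
    (eps M : R) :
  0 <= eps -> 0 <= M -> (forall s, 0 <= w s) ->
  (forall s, w s != 0 -> expR (dotv theta (v s)) <= M) ->
  (forall h, h \in affine_halfspaces v ->
     \sum_s w s * (s \in h)%:R - emp R u h <= eps) ->
  \sum_s w s * expR (dotv theta (v s)) - M * eps <=
  n%:R^-1 * \sum_i expR (dotv theta (v (u i))).
Proof.
move=> e0 M0 w0 wM hdev.
pose f s := expR (dotv theta (v s)).
(* Clipping at M keeps the super-level sets half-spaces (or empty). *)
pose g s := Num.min (f s) M.
pose c s := w s - n%:R^-1 * \sum_i (u i == s)%:R.
have pick (F : T -> R) i : \sum_s (u i == s)%:R * F s = F (u i).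
  rewrite (bigD1 (u i)) //= eqxx mul1r big1 ?addr0 // => s.
  by rewrite eq_sym => /negbTE ->; rewrite mul0r.
have cE (F : T -> R) :
    \sum_s c s * F s = \sum_s w s * F s - n%:R^-1 * \sum_i F (u i).
  under eq_bigr do rewrite mulrBl.
  rewrite sumrB; congr (_ - _).
  under eq_bigr do rewrite -mulrA mulr_suml.
  rewrite -mulr_sumr exchange_big /=; congr (_ * _).
  by apply: eq_bigr => i _; exact: pick.
have main : \sum_s c s * g s <= M * eps.
  apply: layer_cake_le => // [s|t t0].
    by rewrite le_min expR_ge0 M0 /= ge_min lexx orbT.
  have [tM|Mt] := ltP t M; last first.
    by rewrite big_pred0 // => s; rewrite lt_min [t < M]ltNge Mt andbF.
  apply: le_trans (hdev _ (expR_level_halfspace v theta t0)).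
  rewrite -[X in X - _]/(\sum_s w s * (fun s => (s \in [set s | t < f s])%:R) s).
  rewrite -(cE (fun s => (s \in [set s | t < f s])%:R)) big_mkcond.
  apply: ler_eq; apply: eq_bigr => s _; rewrite inE lt_min tM andbT.
  by case: ifP; rewrite ?mulr1 ?mulr0.
rewrite cE in main.
(* Clipping changes nothing on the support of [w] and can only lower the sample mean. *)
have -> : \sum_s w s * f s = \sum_s w s * g s.
  apply: eq_bigr => s _; have [->|ws] := eqVneq (w s) 0; first by rewrite !mul0r.
  by rewrite /g min_l // wM.
rewrite lerBlDr -lerBlDl; apply: le_trans main.
rewrite lerB // ler_wpM2l ?invr_ge0 ?ler0n //.
by apply: ler_sum => i _; rewrite ge_min lexx.
Qed.

(** * The uniform law and i.i.d. probabilities *)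

Definition unif (R : realType) (T : finType) (A : {set T}) (s : T) : R :=
  if s \in A then #|A|%:R^-1 else 0.

Lemma unif_ge0 (R : realType) (T : finType) (A : {set T}) (s : T) :
  0 <= unif R A s.
Proof. by rewrite /unif; case: ifP; rewrite // invr_ge0. Qed.

Lemma sum_unif (R : realType) (T : finType) (A : {set T}) (F : T -> R) :
  \sum_s unif R A s * F s = #|A|%:R^-1 * \sum_(s in A) F s.
Proof.
rewrite mulr_sumr [RHS]big_mkcond /=; apply: eq_bigr => s _.
by rewrite /unif; case: ifP; rewrite ?mul0r.
Qed.

Lemma sum_unif1 (R : realType) (T : finType) (A : {set T}) : (0 < #|A|)%N ->
  \sum_s unif R A s = 1.
Proof.
move=> A0; have := sum_unif A (fun=> 1 : R).
under eq_bigr do rewrite mulr1.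
by rewrite sumr_const mulVf // pnatr_eq0 -lt0n.
Qed.

Lemma iid_prob_ge0 (R : realType) (T : finType) (A : {set T}) (n : nat)
    (E : n.-tuple T -> Prop) : 0 <= iid_prob R A E.
Proof.
apply: sumr_ge0 => U _; apply: prodr_ge0 => i _.
exact: (unif_ge0 R A (tnth U i)).
Qed.

(** Passes to the complement of the bad event, all weights summing to 1, and identifies tuples with
    finite functions. *)
Lemma iid_prob_ge (R : realType) (T : finType) (A : {set T}) (n : nat)
    (E : n.-tuple T -> Prop) (bad : pred {ffun 'I_n -> T}) (eta : R) :
  (0 < #|A|)%N ->
  \sum_(u | bad u) iid_weight (unif R A) u <= eta ->
  (forall U : n.-tuple T, ~~ bad [ffun i => tnth U i] -> E U) ->
  1 - eta <= iid_prob R A E.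
Proof.
move=> A0 hbad hE.
rewrite -(sum_iid_weight n (sum_unif1 R A0)) (bigID bad) /= lerBlDr addrC lerD //.
rewrite (reindex (@finfun_of_tuple T n)) /=; last first.
  by exists (@tuple_of_finfun T n) => u _;
    rewrite ?finfun_of_tupleK ?tuple_of_finfunK.
rewrite big_mkcond [leRHS]big_mkcond /=; apply: ler_sum => U _.
have W0 : 0 <= iid_weight (unif R A) [ffun i => tnth U i].
  by apply: iid_weight_ge0 => s; exact: unif_ge0.
have WE : iid_weight (unif R A) [ffun i => tnth U i] =
    \prod_(i < n) (if tnth U i \in A then #|A|%:R^-1 else 0).
  by apply: eq_bigr => i _; rewrite ffunE.
rewrite -WE; case: asboolP => [_|nE]; first by case: ifP.
by case: ifP => // /hE.
Qed.

Lemma le_iid_prob (R : realType) (T : finType) (A : {set T}) (n : nat)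
    (E E' : n.-tuple T -> Prop) : (forall U, E U -> E' U) ->
  iid_prob R A E <= iid_prob R A E'.
Proof.
move=> EE'; rewrite /iid_prob big_mkcond [leRHS]big_mkcond /=.
apply: ler_sum => U _; case: asboolP => [/EE' e|_]; first by rewrite asboolT.
case: ifP => // _; apply: prodr_ge0 => i _.
exact: (unif_ge0 R A (tnth U i)).
Qed.

(** * The bounds on the logistic risk *)

(** The factor 1/2 pays for the linear bound: - ln (1 - z/2) <= 1/(1 - z/2) - 1 <= z up to z = 1,
    whereas - ln (1 - z) is unbounded there. *)
Lemma ln_gap_le (R : realType) (a b z : R) :
  0 < a -> 0 <= z < 1 -> a * (1 - z / 2) <= b ->
  ln a - ln b <= - ln (1 - z) /\ ln a - ln b <= z.
Proof.
move=> a0 /andP[z0 z1] ab.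
have z2 : 0 < 1 - z / 2 by lra.
have b0 : 0 < b by apply: lt_le_trans ab; exact: mulr_gt0.
have h : ln a + ln (1 - z / 2) <= ln b.
  by rewrite -lnM ?posrE // ler_ln ?posrE // mulr_gt0.
split.
  have : ln (1 - z) <= ln (1 - z / 2) by rewrite ler_ln ?posrE //; lra.
  lra.
have e : 1 + ((1 - z / 2)^-1 - 1) = (1 - z / 2)^-1 by ring.
have := @le_ln1Dx R ((1 - z / 2)^-1 - 1).
rewrite e lnV ?posrE // => k.
have {}k : - ln (1 - z / 2) <= (1 - z / 2)^-1 - 1.
  by apply: k; rewrite ltrBrDr addNr invr_gt0.
have : (1 - z / 2)^-1 <= 1 + z.
  by rewrite -[leLHS]mul1r ler_pdivrMr //; nra.
lra.
Qed.

Section Risk.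
Variables (R : realType) (m d : nat) (x : 'I_m -> 'rV[R]_d) (y : signature m).
Variables (Theta : set 'rV[R]_d) (r : R) (Sr : {set signature m}).
Hypotheses (m_gt0 : (0 < m)%N) (d_gt0 : (0 < d)%N) (r_gt0 : 0 < r).
Hypothesis Theta_lt : forall theta, Theta theta -> norm2 theta < r.
Hypothesis Sr_gt0 : (0 < #|Sr|)%N.

Definition sup_exp : R := sup [set max_exp x y Sr theta' | theta' in Theta]%classic.

Lemma max_rado_norm_ge0 : 0 <= max_rado_norm x y Sr.
Proof. exact: bigmax_ge_id. Qed.

(** The supremum is taken over a bounded set: by Cauchy-Schwarz every exponent is at most
    [r * max_rado_norm x y Sr]. *)
Lemma max_exp_le_sup_exp (theta : 'rV[R]_d) : Theta theta ->
  max_exp x y Sr theta <= sup_exp.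
Proof.
move=> tT; apply: ub_le_sup; last by exists theta.
exists (expR (r * max_rado_norm x y Sr)) => _ [t tt <-].
apply: bigmax_le => [|s sS]; first exact: expR_ge0.
rewrite ler_expR -mulN1r -dotvZr.
apply: le_trans (dotv_le_radius _ (Theta_lt tt)) _; rewrite ler_pM2l //.
rewrite {1}/norm2 dotvZr dotvC dotvZr !mulN1r opprK.
exact: (le_bigmax_cond _ (fun s => norm2 (rado x y s))).
Qed.

Lemma expR_le_sup_exp (theta : 'rV[R]_d) (s : signature m) :
  Theta theta -> s \in Sr -> expR (- dotv theta (rado x y s)) <= sup_exp.
Proof.
move=> tT sS; apply: le_trans (max_exp_le_sup_exp tT).
exact: (le_bigmax_cond _ (fun s => expR (- dotv theta (rado x y s)))).
Qed.

(** The denominator is a mean over [Sr] of terms that the supremum dominates. *)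
Lemma varrho_ge1 (theta : 'rV[R]_d) : Theta theta ->
  1 <= varrho x y Theta Sr theta.
Proof.
move=> tT; rewrite /varrho -/sup_exp ler_pdivlMr ?exp_rado_risk_gt0 // mul1r.
rewrite exp_rado_risk_enum mulrC ler_pdivrMr ?ltr0n //.
rewrite mulr_natr -sumr_const; apply: ler_sum => s sS; exact: expR_le_sup_exp.
Qed.

(** Turns an additive error proportional to [sup_exp] into a relative one. *)
Lemma sup_exp_varrho (theta : 'rV[R]_d) :
  sup_exp = exp_rado_risk x y (enum Sr) theta * varrho x y Theta Sr theta.
Proof. by rewrite /varrho mulrC divfK // lt0r_neq0 ?exp_rado_risk_gt0. Qed.

Section Sample.
Variables (n : nat) (eta : R).
Hypotheses (n_gt0 : (0 < n)%N) (d_le : (d <= 2 * n)%N).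
Hypotheses (eta_gt0 : 0 < eta) (eta_lt1 : eta < 1).

Let L : R := ln (2 * expR 1 * n%:R / d%:R).
Let K : R := r * max_rado_norm x y Sr + d%:R * L + ln eta^-1.
Let eps : R := 4 * Num.sqrt K / Num.sqrt n%:R.

Let nR : 0 < n%:R :> R. Proof. by rewrite ltr0n. Qed.
Let dR : 0 < d%:R :> R. Proof. by rewrite ltr0n. Qed.

Let L_ge0 : 0 <= L.
Proof.
apply: ln_ge0; rewrite ler_pdivlMr // mul1r.
have : d%:R <= 2 * n%:R :> R by rewrite -natrM ler_nat.
move=> /le_trans; apply; rewrite -mulrA mulrCA -[leLHS]mul1r ler_wpM2r ?mulr_ge0 //.
by rewrite -[leLHS]addr0 (le_trans _ (expR_ge1Dx 1)) // lerD2l.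
Qed.

Let lneta_ge0 : 0 <= ln eta^-1.
Proof. by apply: ln_ge0; rewrite invf_ge1 // ltW. Qed.

Let K_ge0 : 0 <= K.
Proof.
by rewrite !addr_ge0 // mulr_ge0 ?max_rado_norm_ge0 ?ler0n //; exact: ltW.
Qed.

Let smallqE (theta : 'rV[R]_d) :
  smallq 8 x y Theta r Sr n eta theta / Num.sqrt n%:R / 2 =
  varrho x y Theta Sr theta * eps.
Proof. by rewrite /smallq -/L -/K /eps; field; rewrite lt0r_neq0 ?sqrtr_gt0. Qed.

(* [smallq 8] is twice the deviation that the half-space argument gives; this
   slack keeps the true relative deviation below 1/2 when [smallq 8 < sqrt n]. *)
Lemma iid_prob_exp_rado_risk :
  1 - eta <= iid_prob R Sr (fun U : n.-tuple (signature m) =>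
    forall theta, Theta theta ->
      smallq 8 x y Theta r Sr n eta theta < Num.sqrt n%:R ->
      exp_rado_risk x y (enum Sr) theta *
        (1 - smallq 8 x y Theta r Sr n eta theta / Num.sqrt n%:R / 2) <=
      exp_rado_risk x y U theta).
Proof.
have sn0 : 0 < Num.sqrt n%:R :> R by rewrite sqrtr_gt0.
have eps0 : 0 <= eps by rewrite /eps divr_ge0 ?mulr_ge0 ?sqrtr_ge0.
(* When [eps > 2], the condition on [smallq] would give varrho eps < 1/2 although varrho >= 1, so
   the event holds for every sample. *)
have [eps2|eps2] := leP eps 2; last first.
  apply: (iid_prob_ge (bad := pred0)) => //.
    by rewrite big_pred0_eq ltW.
  move=> U _ theta tT; rewrite -[X in _ < X]mul1r -ltr_pdivrMr // => small.
  exfalso; have := smallqE theta; have := varrho_ge1 tT; nra.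
pose v s : 'rV[R]_d := (-1) *: rado x y s.
have vE theta s : dotv theta (v s) = - dotv theta (rado x y s).
  by rewrite /v dotvZr mulN1r.
pose H := affine_halfspaces v.
pose bad (u : {ffun 'I_n -> signature m}) := [exists h in H,
  eps < \sum_s unif R Sr s * (s \in h)%:R - emp R u h].
apply: (iid_prob_ge (bad := bad)) => //.
  have := deviation_prob_le (@unif_ge0 R _ Sr) (sum_unif1 R Sr_gt0) n_gt0 eps0 eps2
    (fun X => card_traces_affine v d_gt0 d_le (X := X)).
  move=> /le_trans; apply; rewrite -expRD -/L.
  (* The factor 4 in [eps] is chosen for this. Of the exponent 2K, the part 2dL absorbs the count of
     traces, and the rest is at least ln (1/eta). *)
  have -> : n%:R * eps ^+ 2 / 8 = 2 * K.
    rewrite /eps expr_div_n exprMn !sqr_sqrtr ?ler0n //; field.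
    exact: lt0r_neq0.
  rewrite -[leRHS]lnK ?posrE // ler_expR.
  have := mulr_ge0 (ltW r_gt0) max_rado_norm_ge0; have := lneta_ge0.
  rewrite /K lnV ?posrE //; lra.
move=> U /exists_inPn good theta tT _; rewrite smallqE mulrBr mulr1 mulrA.
rewrite -sup_exp_varrho.
have M0 : 0 <= sup_exp.
  by rewrite (sup_exp_varrho theta) mulr_ge0 // ltW ?exp_rado_risk_gt0 //
    (lt_le_trans ltr01) // varrho_ge1.
have := @exp_risk_deviation R _ d n v (unif R Sr) [ffun i => tnth U i] theta
  eps sup_exp eps0 M0 (@unif_ge0 R _ Sr).
under eq_bigr do rewrite vE.
rewrite sum_unif -exp_rado_risk_enum => dev; apply: (le_trans (dev _ _)).
- move=> s; rewrite vE /unif; case: ifP => [sS _|]; last by rewrite eqxx.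
  exact: expR_le_sup_exp.
- by move=> h hH; rewrite leNgt good.
- rewrite /exp_rado_risk size_tuple big_tuple; apply: ler_eq; congr (_ * _).
  by apply: eq_bigr => i _; rewrite vE ffunE.
Qed.

Lemma max_rado_norm_le :
  max_rado_norm x y Sr <= m%:R * max_scaled_rado_norm x y Sr.
Proof.
have mR : 0 < m%:R :> R by rewrite ltr0n.
apply: bigmax_le => [|s sS]; first by rewrite mulr_ge0 ?ler0n ?bigmax_ge_id.
rewrite -ler_pdivrMl // -norm2Z ?invr_ge0 ?ler0n //.
exact: (le_bigmax_cond _ (fun s => norm2 (m%:R^-1 *: rado x y s))).
Qed.

(** The left side is m^(-1/2) sqrt (K/(nm)), and m^(-1/2) <= m^(-beta) for m >= 1. Since d >= 1, the
    term ln (1/eta) is at most d ln (1/eta). *)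
Lemma sqrt_complexity_le (beta : R) : beta < 2^-1 ->
  m%:R^-1 * (Num.sqrt K / Num.sqrt n%:R) <=
  (m%:R `^ beta)^-1 *
  Num.sqrt (r * max_scaled_rado_norm x y Sr / n%:R
            + d%:R / (n%:R * m%:R) * ln (2 * expR 1 * n%:R / (d%:R * eta))).
Proof.
move=> beta2; set T := _ + _ * ln _.
have mR : 0 < m%:R :> R by rewrite ltr0n.
have m1 : 1 <= m%:R :> R by rewrite ler1n.
have lnE : ln (2 * expR 1 * n%:R / (d%:R * eta)) = L + ln eta^-1.
  rewrite /L -lnM ?posrE ?divr_gt0 ?mulr_gt0 ?expR_gt0 ?invr_gt0 //.
  by congr ln; field; rewrite !lt0r_neq0.
have KT : K / n%:R / m%:R <= T.
  rewrite !ler_pdivrMr // /T lnE.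
  have -> : (r * max_scaled_rado_norm x y Sr / n%:R +
      d%:R / (n%:R * m%:R) * (L + ln eta^-1)) * m%:R * n%:R =
      r * (m%:R * max_scaled_rado_norm x y Sr) + d%:R * L + d%:R * ln eta^-1.
    by field; rewrite !lt0r_neq0.
  apply: lerD; first by rewrite lerD2r ler_pM2l // max_rado_norm_le.
  by rewrite ler_peMl // ler1n.
have -> : m%:R^-1 * (Num.sqrt K / Num.sqrt n%:R) =
    (Num.sqrt m%:R)^-1 * Num.sqrt (K / n%:R / m%:R).
  rewrite !sqrtrM ?sqrtrV ?divr_ge0 ?K_ge0 ?ler0n // -{1}[m%:R]sqr_sqrtr ?ler0n //.
  by field; rewrite !lt0r_neq0 ?sqrtr_gt0.
apply: ler_pM; rewrite ?invr_ge0 ?sqrtr_ge0 //; last exact: ler_wsqrtr.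
rewrite lef_pV2 ?posrE ?powR_gt0 ?sqrtr_gt0 // -powR12_sqrt ?ler0n //.
by apply: ler_powR => //; exact: ltW.
Qed.

(** Both bounds are derived from one event, so they hold simultaneously. *)
Lemma iid_prob_bounds (beta : R) : beta < 2^-1 ->
  1 - eta <= iid_prob R Sr (fun U : n.-tuple (signature m) =>
    forall theta, Theta theta ->
      smallq 8 x y Theta r Sr n eta theta < Num.sqrt n%:R ->
      deviation_bound 8 x y Theta r Sr n eta U theta /\
      large_m_bound 8 beta x y Theta r Sr n eta U theta).
Proof.
move=> beta2; apply: (le_trans iid_prob_exp_rado_risk).
apply: le_iid_prob => U dev theta tT small.
have sn0 : 0 < Num.sqrt n%:R :> R by rewrite sqrtr_gt0.
have mR : 0 < m%:R :> R by rewrite ltr0n.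
have vr0 : 0 <= varrho x y Theta Sr theta by exact: le_trans (varrho_ge1 tT).
set z := smallq 8 x y Theta r Sr n eta theta / Num.sqrt n%:R.
have z01 : 0 <= z < 1.
  rewrite ltr_pdivrMr // mul1r small andbT /z /smallq.
  apply: divr_ge0; last exact: sqrtr_ge0.
  by apply: mulr_ge0 => //; apply: mulr_ge0 => //; exact: sqrtr_ge0.
have [gap1 gap2] := ln_gap_le (exp_rado_risk_gt0 x y theta Sr_gt0) z01
  (dev theta tT small).
have m0 : 0 <= m%:R^-1 :> R by rewrite invr_ge0 ler0n.
rewrite /deviation_bound /large_m_bound -/z log_risk_rado // /log_rado_risk bigQE //.
split; first by have := ler_wpM2l m0 gap1; lra.
suff : m%:R^-1 * z <= 8 * (varrho x y Theta Sr theta / m%:R `^ beta *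
   Num.sqrt (r * max_scaled_rado_norm x y Sr / n%:R
     + d%:R / (n%:R * m%:R) * ln (2 * expR 1 * n%:R / (d%:R * eta)))).
  by have := ler_wpM2l m0 gap2; lra.
have := ler_wpM2l (mulr_ge0 (ler0n R 8) vr0) (sqrt_complexity_le beta2).
rewrite /z /smallq -/L -/K; lra.
Qed.

End Sample.
End Risk.

Theorem theorem3 (R : realType) :
  exists C C' : R, 0 < C /\ 0 < C' /\
  (* the inequality ( * ) with high probability, and the bounds on Q *)
  (forall (m d : nat) (x : 'I_m -> 'rV[R]_d) (y : signature m)
     (Theta : set 'rV[R]_d) (r : R) (Sr : {set signature m}),
     (0 < m)%N -> (0 < d)%N -> 0 < r ->
     (forall theta, Theta theta -> norm2 theta < r) ->
     (0 < #|Sr|)%N ->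
     (forall (n : nat) (eta : R),
        (0 < n)%N -> (d <= 2 * n)%N -> 0 < eta ->
        1 - eta <= iid_prob R Sr (fun U : n.-tuple (signature m) =>
          forall theta, Theta theta ->
            smallq C x y Theta r Sr n eta theta < Num.sqrt n%:R ->
            deviation_bound C x y Theta r Sr n eta U theta))
     /\ (forall theta, Theta theta ->
          (Sr = [set: signature m]%SET -> bigQ x y Sr theta = 0) /\
          (Sr <> [set: signature m]%SET ->
           bigQ x y Sr theta <=
             r * (norm2 (grad (log_rado_risk x y (enum [set: signature m]%SET))
                           theta)
                  + norm2 (mean_scaled_rado x y Sr))))) /\
  (* the form for m large *)
  (forall (beta : R) (d n : nat) (r eta : R),
     0 <= beta -> beta < 2^-1 ->
     (0 < d)%N -> (0 < n)%N -> (d <= 2 * n)%N -> 0 < r -> 0 < eta ->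
     exists m0 : nat,
     forall (m : nat) (x : 'I_m -> 'rV[R]_d) (y : signature m)
       (Theta : set 'rV[R]_d) (Sr : {set signature m}),
       (0 < m)%N -> (m0 <= m)%N ->
       (forall theta, Theta theta -> norm2 theta < r) ->
       (0 < #|Sr|)%N ->
       1 - eta <= iid_prob R Sr (fun U : n.-tuple (signature m) =>
         forall theta, Theta theta ->
           smallq C x y Theta r Sr n eta theta < Num.sqrt n%:R ->
           deviation_bound C x y Theta r Sr n eta U theta /\
           large_m_bound C' beta x y Theta r Sr n eta U theta)).
Proof.
(* Each constant is twice the factor 4 in [eps]. *)
exists 8, 8; split => //; split => //; split.
  move=> m d x y Theta r Sr m0 d0 r0 Thr Sr0; split => [n eta n0 dn eta0|theta tT].
    have [eta1|eta1] := leP 1 eta.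
      by apply: (@le_trans _ _ 0); rewrite ?iid_prob_ge0 // subr_le0.
    (* Only the first of the two bounds is kept, so [iid_prob_bounds] is taken at beta = 0. *)
    have half0 : (0 : R) < 2^-1 by rewrite invr_gt0.
    apply: (le_trans (iid_prob_bounds x y m0 d0 r0 Thr Sr0 n0 dn eta0 eta1 half0)).
    by apply: le_iid_prob => U dev theta tT /(dev theta tT)[].
  split=> [->|_]; first exact: bigQ_setT.
  by apply: bigQ_le => //; exact: Thr.
(* The comparison m^(-1/2) <= m^(-beta) already holds from m = 1 on, whence the threshold 0. *)
move=> beta d n r eta _ beta2 d0 n0 dn r0 eta0; exists 0%N.
move=> m x y Theta Sr m0 _ Thr Sr0.
have [eta1|eta1] := leP 1 eta.
  by apply: (@le_trans _ _ 0); rewrite ?iid_prob_ge0 // subr_le0.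
exact: iid_prob_bounds.
Qed.
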